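(* For all natural numbers $N, S$ and every prime number $p$, there exists $T \in \mathbb{N}$ with the following property: for every knot $K$ such that the reduction of $P_K(a,N)$ modulo $p$ (an element of $\mathbb{F}_p[a^{\pm1}]$) has $a$-span at most $S$, there exists a knot $K'$ with braid index $b(K') \le T$ and $P_{K'}(a,N) \equiv P_K(a,N) \pmod p$.
   Context: $P_K(a,z)$ denotes the HOMFLY polynomial of a link $K$, normalised so that the trivial knot has $P=1$ and satisfying $a^{-1} P_{\widehat{\beta \sigma_i^2}} - a P_{\widehat{\beta}} = z P_{\widehat{\beta\sigma_i}}$ for all braids $\beta\in B_n$ and generators $\sigma_i$, where the hat denotes braid closure. For knots, $P_K(a,z)$ is a polynomial in $z$, so $P_K(a,N)\in\mathbb{Z}[a^{\pm1}]$. The $a$-span of a nonzero Laurent polynomial in $a$ is the difference between its maximal and minimal $a$-degrees. $b(K)$ denotes the braid index of $K$, i.e. the minimal number of strands of a braid whose closure is $K$. *)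

(* Defs.v *)
From HB Require Import structures.
From mathcomp Require Import all_boot all_order all_algebra.
From mathcomp Require Import finmap.
From Stdlib Require Import Relations.
Set Implicit Arguments. Unset Strict Implicit. Unset Printing Implicit Defensive.
Import Order.TTheory GRing.Theory Num.Theory.
Local Open Scope ring_scope.

(** * Braids (combinatorial model)
   A letter [(i, true)] is the Artin generator sigma_{i+1}, [(i, false)] its
   inverse (0-indexed).  A braid is a pair [(n, w)]: n strands, word w. *)
Definition letter := (nat * bool)%type.
Definition braid := (nat * seq letter)%type.

Definition wf_braid (b : braid) : bool :=
  (0 < b.1)%N && all (fun l : letter => (l.1.+1 < b.1)%N) b.2.

(** Elementary moves: free cancellation, far commutation, braid relation
    (these generate the braid group B_n), cyclic rotation (conjugation),
    and Markov stabilisation beta |-> beta sigma_n^{+-1}. *)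
Inductive markov_step : braid -> braid -> Prop :=
| ms_cancel n (u v : seq letter) i s :
    markov_step (n, u ++ (i, s) :: (i, ~~ s) :: v) (n, u ++ v)
| ms_far n (u v : seq letter) i j s t : (i.+1 < j)%N ->
    markov_step (n, u ++ (i, s) :: (j, t) :: v) (n, u ++ (j, t) :: (i, s) :: v)
| ms_braid n (u v : seq letter) i :
    markov_step (n, u ++ [:: (i, true); (i.+1, true); (i, true)] ++ v)
                (n, u ++ [:: (i.+1, true); (i, true); (i.+1, true)] ++ v)
| ms_conj n (x : letter) w : markov_step (n, x :: w) (n, rcons w x)
| ms_stab n w s : markov_step (n, w) (n.+1, rcons w (n.-1, s)).

(** Two (well-formed) braids have isotopic closures iff they are related by
    these moves (Alexander + Markov theorems). *)
Definition markov_eq : relation braid :=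
  clos_refl_sym_trans braid
    (fun b c => [/\ wf_braid b, wf_braid c & markov_step b c]).

Definition swapn (i k : nat) : nat :=
  if k == i then i.+1 else if k == i.+1 then i else k.
Definition braid_perm (b : braid) : nat -> nat :=
  foldr (fun (l : letter) f => f \o swapn l.1) id b.2.

(** The closure of b is a knot (one component). *)
Definition is_knot (b : braid) : Prop :=
  wf_braid b /\
  forall k, (k < b.1)%N -> exists m, iter m (braid_perm b) 0%N = k.

Definition is_braid_index (b : braid) (m : nat) : Prop :=
  (exists b', markov_eq b b' /\ b'.1 = m) /\
  (forall b', markov_eq b b' -> (m <= b'.1)%N).

(** * Laurent polynomials in a, z with integer coefficients:
    [f (i, j)] is the coefficient of a^i z^j. *)
Definition laurent2 := {fsfun int * int -> int with 0}.

Definition is_HOMFLY (P : braid -> laurent2) : Prop :=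
  [/\ (forall b c, markov_eq b c -> P b = P c),
      (forall k, P (1%N, [::]) k = (if k == (0, 0) then 1 else 0)) &
      (forall n w i, wf_braid (n, w) -> (i.+1 < n)%N -> forall x y : int,
         P (n, w ++ [:: (i, true); (i, true)]) (x + 1, y) - P (n, w) (x - 1, y)
         = P (n, rcons w (i, true)) (x, y - 1))].

(** Coefficient of a^i in f(a, N) (only nonnegative powers of z are used;
    for knots no negative z-powers occur). *)
Definition evalN (f : laurent2) (N : nat) (i : int) : int :=
  \sum_(k <- finsupp f | k.1 == i)
     f k * (if (0 <= k.2) then (N%:Z) ^+ `|k.2|%N else 0).

(* Main.v *)
(** Evaluate at [z = N] modulo [p].  Inserting a full twist [sigma_i^2] at the
    end of a braid [w] closing to a knot acts, up to the degree shift [a^2], on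
    the pair [(P_w, z P_(w sigma_i))] by an invertible 2x2 matrix over the finite
    field [F_p]; a power [d] of this matrix is the identity, so [d] full twists
    multiply [P(a, N) mod p] by [a^(2d)] without changing the number of strands
    or the number of components.  Up to shifts by multiples of [2d] there are
    finitely many polynomials of bounded span over [F_p]; choose one knot for
    each that occurs, and let [T] be the largest number of strands needed.

    The recursion evaluates at [z = N], possibly [0], so knots must have no
    negative powers of [z]; more generally [P_L in z^(1-c) Z[a^+-1, z]] for a
    [c]-component link [L].  That bound is stable under the skein relation,
    which reduces every braid word on [n+1] strands to words containing
    [sigma_n] at most once; those are handled by conjugation and
    (de)stabilisation. *)
Require Import Defs.
From HB Require Import structures.
From mathcomp Require Import all_boot all_order all_algebra.
From mathcomp Require Import fingroup perm finmap zify ring.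
From Stdlib Require Import Relations Classical.
Import Order.TTheory GRing.Theory Num.Theory.
Local Open Scope ring_scope.

(** * Normal form of braid words modulo the skein relation *)

Definition letters_below (n : nat) (w : seq letter) : bool :=
  all (fun l : letter => (l.1.+1 < n)%N) w.

(** In the Hecke algebra such a word is a linear combination of words of [B]; coefficients are left
    out, since only vanishing of low powers of z is transported. No rule is a conjugation, so
    subwords can be rewritten in context. *)
Inductive skein_span (B : seq letter -> Prop) : seq letter -> Prop :=
| span_base w : B w -> skein_span B w
| span_far u v i j s t : (i.+1 < j)%N || (j.+1 < i)%N ->
    skein_span B (u ++ (i, s) :: (j, t) :: v) ->
    skein_span B (u ++ (j, t) :: (i, s) :: v)
| span_braid u v i :
    skein_span B (u ++ [:: (i, true); (i.+1, true); (i, true)] ++ v) ->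
    skein_span B (u ++ [:: (i.+1, true); (i, true); (i.+1, true)] ++ v)
| span_sq u v i : skein_span B (u ++ v) -> skein_span B (u ++ (i, true) :: v) ->
    skein_span B (u ++ (i, true) :: (i, true) :: v)
| span_neg u v i : skein_span B (u ++ v) -> skein_span B (u ++ (i, true) :: v) ->
    skein_span B (u ++ (i, false) :: v).

Lemma skein_span_context (B B' : seq letter -> Prop) (u v w : seq letter) :
  skein_span B w -> (forall b, B b -> skein_span B' (u ++ b ++ v)) ->
  skein_span B' (u ++ w ++ v).
Proof.
move=> Hw HB; elim: Hw => {w}
  [w|u' v' i j s t ij _|u' v' i _|u' v' i _ IH1 _|u' v' i _ IH1 _].
- exact: HB.
- by rewrite -!catA /= !(catA u) => IH; apply: span_far.
- by rewrite -!catA !(catA u) => IH; apply: span_braid.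
- by move: IH1; rewrite -!catA /= !(catA u) => IH1 IH2; apply: span_sq.
- by move: IH1; rewrite -!catA /= !(catA u) => IH1 IH2; apply: span_neg.
Qed.

Lemma skein_span_commute_left (B : seq letter -> Prop) t (u x v : seq letter) :
  letters_below t x ->
  skein_span B (u ++ x ++ (t, true) :: v) -> skein_span B (u ++ (t, true) :: x ++ v).
Proof.
elim: x u => [|[j s] x IH] u //= /andP[jt xt] H.
apply: span_far; first by rewrite jt.
by rewrite -cat_rcons; apply: IH => //; rewrite cat_rcons.
Qed.

Lemma skein_span_commute_right (B : seq letter -> Prop) t (u x v : seq letter) :
  letters_below t x ->
  skein_span B (u ++ (t, true) :: x ++ v) -> skein_span B (u ++ x ++ (t, true) :: v).
Proof.
elim: x u => [|[j s] x IH] u //= /andP[jt xt] H.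
rewrite -cat_rcons; apply: IH => //; rewrite cat_rcons.
by apply: span_far => //; rewrite jt orbT.
Qed.

(** On [n.+1] strands, [(n.-1, true)] is the last generator sigma_n. *)
Definition top_normal (n : nat) (w : seq letter) : Prop :=
  letters_below n w \/
  exists u v, [/\ letters_below n u, letters_below n v & w = u ++ (n.-1, true) :: v].

Lemma letters_belowW m n w : (m <= n)%N -> letters_below m w -> letters_below n w.
Proof. by move=> mn; apply: sub_all => l /leq_trans; apply. Qed.

Lemma letters_below_cat n u v :
  letters_below n (u ++ v) = letters_below n u && letters_below n v.
Proof. exact: all_cat. Qed.

(** Put [v] in normal form with respect to sigma_(n-1). Without that letter it commutes with
    sigma_n, and the two top letters meet in a square; with it, the braid relation applied to
    sigma_n sigma_(n-1) sigma_n leaves one sigma_n. *)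
Lemma skein_span_two_tops n u v :
  (forall w, letters_below n w -> (0 < n.-1)%N -> skein_span (top_normal n.-1) w) ->
  letters_below n u -> letters_below n v ->
  skein_span (top_normal n) (u ++ ((n.-1, true) :: v) ++ [:: (n.-1, true)]).
Proof.
move=> IHn Hu Hv.
have base x y : letters_below n x -> letters_below n y ->
    skein_span (top_normal n) (x ++ (n.-1, true) :: y).
  by move=> Hx Hy; apply: span_base; right; exists x, y.
have low x : letters_below n.-1 x ->
    skein_span (top_normal n) (u ++ (n.-1, true) :: x ++ [:: (n.-1, true)]).
  move=> Hx; apply: skein_span_commute_left => //; rewrite catA.
  have Hux : letters_below n (u ++ x).
    by rewrite letters_below_cat Hu (letters_belowW _ _ _ (leq_pred n) Hx).
  apply: span_sq; first by apply: span_base; left; rewrite cats0.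
  exact: base.
have [n1|n1] := posnP n.-1.
  (* Here [n <= 1], so no letter lies below [n] and [v] is empty. *)
  apply: low; case: v Hv => // l v /andP[].
  by case: l => i s; lia.
rewrite (_ : _ ++ _ = (u ++ [:: (n.-1, true)]) ++ v ++ [:: (n.-1, true)]);
  last by rewrite -!catA.
apply: skein_span_context (IHn v Hv n1) _ => b [Hb|[x [y [Hx Hy ->]]]].
  by rewrite -catA; apply: low.
have En : n.-1 = n.-2.+1 by lia.
rewrite -!catA /=.
(* [x] moves out to the left of the first top letter, then [y] to the right of the second. *)
apply: skein_span_commute_left => //.
rewrite catA.
suff: skein_span (top_normal n)
    (((u ++ x) ++ [:: (n.-1, true); (n.-2, true)]) ++ y ++ (n.-1, true) :: [::]).
  by rewrite -!catA.
apply: skein_span_commute_right => //.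
rewrite cats0 -catA [X in _ ++ X]/= En.
apply: (span_braid _ (u ++ x) y n.-2); rewrite -En -catA /=.
suff: skein_span (top_normal n)
    ((u ++ x ++ [:: (n.-2, true)]) ++ (n.-1, true) :: (n.-2, true) :: y).
  by rewrite -!catA.
have wk := letters_belowW _ _ _ (leq_pred n).
apply: base; rewrite ?letters_below_cat ?Hu ?(wk _ Hx) /=; first by rewrite andbT; lia.
by rewrite (wk _ Hy) andbT; lia.
Qed.

(** Induction on [n], then on the word, appending one letter to a normal form; only a second top
    letter needs work. *)
Lemma skein_span_top_normal n w :
  (0 < n)%N -> letters_below n.+1 w -> skein_span (top_normal n) w.
Proof.
elim/ltn_ind: n w => n IHn w n0; elim/last_ind: w => [|w [i s] IHw].
  by move=> _; apply: span_base; left.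
rewrite -cats1 letters_below_cat /= andbT => /andP[Hw Hi].
have {}IHw := IHw Hw.
have pos : skein_span (top_normal n) (w ++ [:: (i, true)]).
  rewrite -[_ ++ _]cat0s.
  apply: skein_span_context IHw _ => b; have [Hin|Hin] := ltnP i.+1 n.
    move=> [Hb|[x [y [Hx Hy ->]]]]; apply: span_base => /=; [left|right].
      by rewrite letters_below_cat Hb /= Hin.
    exists x, (y ++ [:: (i, true)]); split=> //; last by rewrite -catA.
    by rewrite letters_below_cat Hy /= Hin.
  have -> : i = n.-1 by lia.
  move=> [Hb|[x [y [Hx Hy ->]]]] /=.
    by apply: span_base; right; exists b, [::].
  rewrite -catA; apply: skein_span_two_tops => // z Hz n1.
  apply: IHn => //; first by lia.
  by rewrite prednK.
by case: s => //; apply: span_neg => //; rewrite cats0.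
Qed.

(** * Counting components *)

(** The point set is fixed, so that an induction on the number of strands stays in one type. *)
Definition word_perm (M : nat) (w : seq letter) : {perm 'I_M.+1} :=
  foldr (fun (l : letter) s => mulg (tperm (inord l.1) (inord l.1.+1)) s) 1%g w.

Definition cycles (M : nat) (w : seq letter) : nat := #|porbits (word_perm M w)|.

Lemma word_perm_cat M (u v : seq letter) :
  word_perm M (u ++ v) = (word_perm M u * word_perm M v)%g.
Proof. by elim: u => [|l u IH] /=; rewrite ?mul1g // IH mulgA. Qed.

(** For the permutations a, b of [u], [v], the product ba is b(ab)b^-1, so b^-1 carries the orbits
    of ab to those of ba. *)
Lemma cyclesC M (u v : seq letter) : cycles M (u ++ v) = cycles M (v ++ u).
Proof.
rewrite /cycles !word_perm_cat.
set a := word_perm M u; set b := word_perm M v.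
have porbJ x : porbit (b * a)%g (b^-1 x)%g = (b^-1)%g @: porbit (a * b)%g x.
  have Xc k : ((b * a) ^+ k = b * (a * b) ^+ k * b^-1)%g.
    elim: k => [|k IH]; first by rewrite !expg0 mulg1 mulgV.
    by rewrite !expgS IH !mulgA.
  apply/setP => y; apply/porbitP/imsetP => [[k ->]|[z /porbitP[k ->] ->]].
    exists (((a * b) ^+ k)%g x); first by apply/porbitP; exists k.
    by rewrite Xc !permM permKV.
  by exists k; rewrite Xc !permM permKV.
have -> : porbits (b * a)%g = (fun X : {set _} => (b^-1)%g @: X) @: porbits (a * b)%g.
  apply/setP => X; apply/imsetP/imsetP => [[x _ ->]|[Y /imsetP[x _ ->] ->]].
    exists (porbit (a * b)%g (b x)); first exact: imset_f.
    by rewrite -porbJ permK.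
  by exists (b^-1 x)%g; rewrite // porbJ.
by rewrite card_imset //; apply: imset_inj; apply: perm_inj.
Qed.

Lemma cycles_nil M : cycles M [::] = M.+1.
Proof.
rewrite /cycles /= card_imset ?card_ord // => x y /setP /(_ y).
by rewrite porbit_id => /porbitP[k ->]; rewrite expg1n perm1.
Qed.

Lemma cycles_cons M (l : letter) (w : seq letter) :
  (cycles M (l :: w) +
    (inord l.1 \notin porbit (word_perm M w) (inord l.1.+1)).*2)%N =
  (cycles M w + (inord l.1 != inord l.1.+1 :> 'I_M.+1))%N.
Proof. exact: porbits_mul_tperm. Qed.

Lemma cycles_insert M (u v : seq letter) (l : letter) :
  (cycles M (u ++ l :: v) <= (cycles M (u ++ v)).+1)%N.
Proof.
rewrite cyclesC (cyclesC M u); have := cycles_cons M l (v ++ u).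
by case: (_ \notin _); case: (_ != _) => /=; lia.
Qed.

Lemma cycles_cancel M (u v : seq letter) i s t :
  cycles M (u ++ (i, s) :: (i, t) :: v) = cycles M (u ++ v).
Proof.
by rewrite /cycles !word_perm_cat /= !mulgA -(mulgA (word_perm M u)) tperm2 mulg1.
Qed.

Lemma cycles_sign M (u v : seq letter) i s t :
  cycles M (u ++ (i, s) :: v) = cycles M (u ++ (i, t) :: v).
Proof. by rewrite /cycles !word_perm_cat. Qed.

Lemma word_perm_fix M n (w : seq letter) k :
  (n <= M)%N -> (n <= k)%N -> (k <= M)%N -> letters_below n w ->
  word_perm M w (inord k) = inord k.
Proof.
move=> nM nk kM; elim: w => [|[i s] w IH] /=; first by rewrite perm1.
move=> /andP[i_n Hw]; rewrite permM tpermD ?IH // -val_eqE /= !inordK; lia.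
Qed.

(** Point [n] is fixed by [w], so the new transposition merges a singleton into another cycle. *)
Lemma cycles_stab M n (w : seq letter) s : (0 < n)%N -> (n <= M)%N -> letters_below n w ->
  (cycles M (rcons w (n.-1, s))).+1 = cycles M w.
Proof.
move=> n0 nM Hw; rewrite -cats1 cyclesC /=.
have := cycles_cons M (n.-1, s) w; rewrite /=.
have -> : (inord n.-1 \notin porbit (word_perm M w) (inord n.-1.+1)).
  apply/porbitP => -[k].
  rewrite permX_fix; last by apply: word_perm_fix Hw; lia.
  by move/(congr1 val); rewrite /= !inordK; lia.
have -> : (inord n.-1 != inord n.-1.+1 :> 'I_M.+1).
  by rewrite -val_eqE /= !inordK; lia.
by rewrite /=; lia.
Qed.

Lemma cycles_far M (u v : seq letter) i j s t : (i.+1 < j)%N || (j.+1 < i)%N ->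
  (i < M)%N -> (j < M)%N ->
  cycles M (u ++ (i, s) :: (j, t) :: v) = cycles M (u ++ (j, t) :: (i, s) :: v).
Proof.
move=> ij iM jM; rewrite /cycles !word_perm_cat /= !mulgA -!(mulgA (word_perm M u)).
rewrite [(tperm (inord i) _ * _)%g]conjgC tpermJ !tpermD //;
  rewrite -val_eqE /= !inordK; lia.
Qed.

Lemma cycles_braid M (u v : seq letter) i : (i.+1 < M)%N ->
  cycles M (u ++ [:: (i, true); (i.+1, true); (i, true)] ++ v) =
  cycles M (u ++ [:: (i.+1, true); (i, true); (i.+1, true)] ++ v).
Proof.
move=> iM; rewrite /cycles !word_perm_cat /= !mulg1.
set x := inord i; set y := inord i.+1; set z : 'I_M.+1 := inord i.+2.
have E a b : tperm a b = (tperm a b)^-1%g :> {perm 'I_M.+1} by rewrite tpermV.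
congr (#|porbits (_ * (_ * _))%g|).
(* Both products are conjugates equal to the transposition of [x] and [z]. *)
have -> : (tperm x y * (tperm y z * tperm x y) = tperm y z ^ tperm x y)%g.
  by rewrite conjgE -E.
have -> : (tperm y z * (tperm x y * tperm y z) = tperm x y ^ tperm y z)%g.
  by rewrite conjgE -E.
rewrite !tpermJ tpermL tpermR !tpermD //;
  rewrite -val_eqE /= !inordK; lia.
Qed.

(** * Lower bound on the z-degree *)

Lemma wf_braidE n w : wf_braid (n, w) = (0 < n)%N && letters_below n w.
Proof. by []. Qed.

Lemma wf_braid_stab n (w : seq letter) s :
  wf_braid (n, w) -> wf_braid (n.+1, rcons w (n.-1, s)).
Proof.
rewrite !wf_braidE -cats1 letters_below_cat => /andP[n0 /letters_belowW ->] //=.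
by rewrite andbT; lia.
Qed.

Lemma markov_eq_conj n (u v : seq letter) :
  wf_braid (n, u ++ v) -> markov_eq (n, u ++ v) (n, v ++ u).
Proof.
elim: u v => [|l u IH] v; first by rewrite cats0; constructor 2.
rewrite !wf_braidE => /= /and3P[n0 Hl Huv].
have wf : letters_below n ((u ++ v) ++ [:: l]).
  by rewrite letters_below_cat Huv /= Hl.
have wf' : wf_braid (n, u ++ rcons v l) by rewrite wf_braidE n0 -cats1 catA.
apply: rst_trans (n, u ++ rcons v l) _ _ _; last by rewrite -cat_rcons; exact: IH.
rewrite -rcons_cat; apply: rst_step; split; last exact: ms_conj.
  by rewrite wf_braidE n0 /= Hl.
by rewrite rcons_cat.
Qed.

Lemma homfly_conj {P} (HP : is_HOMFLY P) n (u v : seq letter) :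
  wf_braid (n, u ++ v) -> P (n, u ++ v) = P (n, v ++ u).
Proof. by case: HP => HP _ _ wf; apply: HP; apply: markov_eq_conj. Qed.

Lemma homfly_step {P} (HP : is_HOMFLY P) b c :
  wf_braid b -> wf_braid c -> markov_step b c -> P b = P c.
Proof. by case: HP => HP _ _ wb wc bc; apply: HP; apply: rst_step. Qed.

Lemma homfly_skein {P} (HP : is_HOMFLY P) n (u v : seq letter) i (x y : int) :
  wf_braid (n, u ++ (i, true) :: v) ->
  P (n, u ++ (i, true) :: (i, true) :: v) (x + 1, y) - P (n, u ++ v) (x - 1, y)
  = P (n, u ++ (i, true) :: v) (x, y - 1).
Proof.
rewrite wf_braidE letters_below_cat /= => /and4P[n0 Hu Hi Hv].
have rot w : letters_below n w -> P (n, u ++ w ++ v) = P (n, (v ++ u) ++ w).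
  move=> Hw; rewrite -catA (catA u) (homfly_conj HP n (u ++ w)) -?catA //.
  by rewrite wf_braidE !letters_below_cat n0 Hu Hw.
have Hii : letters_below n [:: (i, true); (i, true)] by rewrite /= Hi.
have Hi1 : letters_below n [:: (i, true)] by rewrite /= Hi.
rewrite (rot [:: _; _] Hii) (rot [::] isT) (rot [:: _] Hi1) cats0 cats1.
case: HP => _ _; apply=> //.
by rewrite wf_braidE n0 letters_below_cat Hv Hu.
Qed.

(** This is [homfly_skein] with sigma_i^-1 inserted before the crossing; two of the three words then
    cancel. *)
Lemma homfly_skein_neg {P} (HP : is_HOMFLY P) n (u v : seq letter) i (x y : int) :
  wf_braid (n, u ++ (i, true) :: v) ->
  P (n, u ++ (i, true) :: v) (x + 1, y) - P (n, u ++ (i, false) :: v) (x - 1, y)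
  = P (n, u ++ v) (x, y - 1).
Proof.
rewrite wf_braidE letters_below_cat /= => /and4P[n0 Hu Hi Hv].
have := homfly_skein HP n (rcons u (i, false)) v i x y; rewrite !cat_rcons.
have cancel w : letters_below n w ->
    P (n, u ++ (i, false) :: (i, true) :: w) = P (n, u ++ w).
  move=> Hw; apply: (homfly_step HP); last exact: (ms_cancel _ _ _ _ false).
    by rewrite wf_braidE letters_below_cat /= n0 Hu Hi Hw.
  by rewrite wf_braidE letters_below_cat n0 Hu Hw.
rewrite !cancel //=; last by rewrite Hi.
by apply; rewrite wf_braidE letters_below_cat /= n0 Hu Hi Hv.
Qed.

(* [cycles M w + n - M.+1] is the number of components of the closure of
   [(n, w)], because the strands beyond [n] are fixed points; this is the bound
   [P in z^(1 - #components) Z[a^+-1, z]]. *)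
Definition low_z_vanish (P : braid -> laurent2) (M n : nat) (w : seq letter) : Prop :=
  wf_braid (n, w) -> forall x y : int,
    y + n%:Z + (cycles M w)%:Z <= M.+1%:Z -> P (n, w) (x, y) = 0.

(** The braid group relations preserve [P] and the cycle count. In the two skein rules, the term
    whose z-exponent drops by one has at most one more cycle, which keeps the bound. *)
Lemma low_z_vanish_span P (HP : is_HOMFLY P) M n B w : (n <= M.+1)%N ->
  (forall b, B b -> low_z_vanish P M n b) -> skein_span B w -> low_z_vanish P M n w.
Proof.
move=> nM HB; elim => {w}
  [//|u v i j s t ij _|u v i _|u v i _ IH1 _ IH2|u v i _ IH1 _ IH2].
- move=> IH wf; have := wf; rewrite wf_braidE letters_below_cat /=.
  move=> /and5P[n0 Hu Hj Hi Hv].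
  have wf' : wf_braid (n, u ++ (i, s) :: (j, t) :: v).
    by rewrite wf_braidE letters_below_cat /= n0 Hu Hi Hj.
  have -> : P (n, u ++ (j, t) :: (i, s) :: v) = P (n, u ++ (i, s) :: (j, t) :: v).
    case/orP: ij => ij; last by apply: (homfly_step HP) => //; apply: ms_far.
    by apply/esym/(homfly_step HP) => //; apply: ms_far.
  by rewrite -(cycles_far _ _ _ _ _ _ _ ij) //; [exact: IH|lia|lia].
- move=> IH wf; have := wf; rewrite wf_braidE letters_below_cat /=.
  move=> /and5P[n0 Hu Hj Hi /andP[_ Hv]].
  have wf' : wf_braid (n, u ++ [:: (i, true); (i.+1, true); (i, true)] ++ v).
    by rewrite wf_braidE letters_below_cat /= n0 Hu Hi Hj.
  rewrite -(homfly_step HP _ _ wf' wf (ms_braid _ _ _ _)).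
  by rewrite -cycles_braid //; [exact: IH|lia].
- rewrite /low_z_vanish wf_braidE letters_below_cat /= => /and5P[n0 Hu Hi _ Hv] x y Hy.
  have wf1 : wf_braid (n, u ++ v) by rewrite wf_braidE n0 letters_below_cat Hu.
  have wf2 : wf_braid (n, u ++ (i, true) :: v).
    by rewrite wf_braidE n0 letters_below_cat /= Hu Hi.
  have := homfly_skein HP n u v i (x - 1) y wf2; rewrite subrK.
  rewrite cycles_cancel in Hy.
  have Hc : (cycles M (u ++ (i, true) :: v) <= (cycles M (u ++ v)).+1)%N.
    exact: cycles_insert.
  by rewrite IH1 // IH2 ?subr0 //; lia.
- rewrite /low_z_vanish wf_braidE letters_below_cat /= => /and4P[n0 Hu Hi Hv] x y Hy.
  have wf1 : wf_braid (n, u ++ v) by rewrite wf_braidE n0 letters_below_cat Hu.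
  have wf2 : wf_braid (n, u ++ (i, true) :: v).
    by rewrite wf_braidE n0 letters_below_cat /= Hu Hi.
  have := homfly_skein_neg HP n u v i (x + 1) y wf2; rewrite addrK.
  have Hc : (cycles M (u ++ v) <= (cycles M (u ++ (i, true) :: v)).+1)%N.
    by rewrite -(cycles_cancel M u v i true true) cycles_insert.
  rewrite (cycles_sign _ _ _ _ _ true) in Hy.
  rewrite IH1 // ?IH2 ?sub0r //; try lia.
  by move/eqP; rewrite oppr_eq0 => /eqP.
Qed.
Lemma low_z_vanishing P (HP : is_HOMFLY P) M n w :
  (n <= M.+1)%N -> low_z_vanish P M n w.
Proof.
elim: n w => [|n IHn] w nM; first by move=> /andP[].
have [n0|n0] := posnP n.
  subst n; case: w => [|[i s] w]; last by move=> /andP[_ /andP[]].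
  (* On one strand the bound forces [y < 0], while [P] is supported at [(0, 0)]. *)
  move=> _ x y; rewrite cycles_nil; case: HP => _ -> _; by case: eqP => [[_ ->]|] //; lia.
move=> wf.
have Hw : skein_span (top_normal n) w.
  by apply: skein_span_top_normal => //; have /andP[] := wf.
apply: (low_z_vanish_span _ HP _ _ _ _ nM _ Hw wf) => {w wf Hw} b.
have {}IHn := IHn _ (ltnW nM).
move=> [Hb wfb x y Hy|[u [v [Hu Hv ->]]] wfb x y].
  have wfn : wf_braid (n, b) by rewrite wf_braidE n0.
  (* Both stabilisations of [b] have the same [P] as [(n, b)], so the skein relation gives
     [P (n.+1, b)] in terms of [P (n, b)] one power of z higher. *)
  have stab s : P (n.+1, rcons b (n.-1, s)) = P (n, b).
    apply/esym/(homfly_step HP) => //; last exact: ms_stab.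
    exact: wf_braid_stab.
  have := homfly_skein_neg HP n.+1 b [::] n.-1 x (y + 1).
  rewrite cats0 !cats1 !stab addrK => <-; last first.
    exact: (wf_braid_stab _ _ true).
  by rewrite !IHn ?subrr //; lia.
have Hvu : letters_below n (v ++ u) by rewrite letters_below_cat Hv.
have wfn : wf_braid (n, v ++ u) by rewrite wf_braidE n0.
have Eu : u ++ (n.-1, true) :: v = (u ++ [:: (n.-1, true)]) ++ v by rewrite -catA.
have wfs : wf_braid (n.+1, rcons (v ++ u) (n.-1, true)).
  exact: wf_braid_stab.
(* Destabilising loses one strand and gains one cycle, so the bound is unchanged. *)
have -> : P (n.+1, u ++ (n.-1, true) :: v) = P (n, v ++ u).
  rewrite Eu in wfb *; rewrite homfly_conj // catA cats1.
  by apply/esym/(homfly_step HP) => //; apply: ms_stab.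
have E : (cycles M (u ++ (n.-1, true) :: v)).+1 = cycles M (v ++ u).
  by rewrite Eu cyclesC catA cats1 (cycles_stab _ n).
by move=> Hy; rewrite IHn //; lia.
Qed.

(** * Knots and evaluation at z = N *)

Lemma braid_perm_cat n (u v : seq letter) :
  braid_perm (n, u ++ v) =1 braid_perm (n, v) \o braid_perm (n, u).
Proof.
rewrite /braid_perm /=; by elim: u => [|l u IH] k //=; rewrite IH.
Qed.

Lemma swapnK i : involutive (swapn i).
Proof. by move=> k; rewrite /swapn; do !case: eqP; lia. Qed.

Lemma is_knot_double n (w : seq letter) i s t : (i.+1 < n)%N ->
  is_knot (n, w) -> is_knot (n, w ++ [:: (i, s); (i, t)]).
Proof.
move=> i_n [wf kn]; split=> [|k kn'].
  by move: wf; rewrite !wf_braidE letters_below_cat => /andP[-> ->] /=; rewrite i_n.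
have [m <-] := kn k kn'; exists m; apply: eq_iter => j.
by rewrite braid_perm_cat /= /braid_perm /= swapnK.
Qed.

Lemma is_knot_nseq n (w : seq letter) i s k : (i.+1 < n)%N ->
  is_knot (n, w) -> is_knot (n, w ++ nseq k.*2 (i, s)).
Proof.
move=> i_n kn; elim: k => [|k IH]; first by rewrite cats0.
rewrite doubleS -addn2 nseqD catA; exact: is_knot_double.
Qed.

Lemma val_word_perm m (w : seq letter) (x : 'I_m.+1) :
  letters_below m.+1 w -> val (word_perm m w x) = braid_perm (m.+1, w) (val x).
Proof.
rewrite /braid_perm /=; elim: w x => [|[i s] w IH] x /=; first by rewrite perm1.
move=> /andP[i_m Hw]; rewrite permM IH //; congr (foldr _ _ _ _).
rewrite /swapn; case: tpermP => [->|->|/eqP xi /eqP xj].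
- by rewrite /= !inordK ?eqxx //; lia.
- by rewrite /= !inordK ?eqxx //; [case: eqP; lia|lia..].
- move: xi xj; rewrite -!val_eqE /= !inordK; [|lia..].
  by move=> /negbTE -> /negbTE ->.
Qed.

Lemma knot_cycles m (w : seq letter) : is_knot (m.+1, w) -> cycles m w = 1%N.
Proof.
move=> [/andP[_ Hw] kn]; rewrite /cycles.
suff -> : porbits (word_perm m w) = [set porbit (word_perm m w) ord0] by rewrite cards1.
apply/setP => X; rewrite inE; apply/imsetP/eqP => [[x _ ->]|->]; last by exists ord0.
apply/eqP; rewrite eq_porbit_mem; apply/porbitP.
have [k Hk] := kn _ (ltn_ord x); exists k; apply: val_inj; rewrite permX -[LHS]Hk.
by elim: k {Hk} => //= k ->; rewrite val_word_perm.
Qed.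

Lemma homfly_knot_vanishing {P} (HP : is_HOMFLY P) n (w : seq letter) (x y : int) :
  is_knot (n, w) -> y < 0 -> P (n, w) (x, y) = 0.
Proof.
move=> kn y0; have [wf _] := kn; case: n kn wf => // m kn wf.
apply: (low_z_vanishing _ HP m _ _ (leqnn _) wf); rewrite knot_cycles //; lia.
Qed.

(** A cutoff that may be enlarged lets several polynomials be compared term by term. *)
Lemma evalN_sum (f : laurent2) (N : nat) :
  exists L0, forall L, (L0 <= L)%N -> forall i,
    evalN f N i = \sum_(y < L) f (i, y%:Z) * N%:Z ^+ y.
Proof.
exists (\max_(k <- finsupp f) `|k.2|.+1)%N => L L0 i.
have bound k : k \in finsupp f -> (`|k.2| < L)%N.
  move=> kf; apply: leq_trans L0.
  by rewrite (big_rem k) //= leq_max leqnn.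
rewrite /evalN (bigID (fun k : int * int => 0 <= k.2)) /=.
rewrite [X in _ + X]big1 ?addr0; last first.
  by move=> k /andP[_ /negbTE ->]; rewrite mulr0.
rewrite -(big_mkord xpredT (fun y => f (i, y%:Z) * N%:Z ^+ y)).
rewrite [RHS](bigID (fun y : nat => (i, y%:Z) \in finsupp f)) /=.
rewrite [X in _ = _ + X]big1 ?addr0; last by move=> y /fsfun_dflt ->; rewrite mul0r.
rewrite -big_filter -[RHS]big_filter.
rewrite (perm_big
  [seq (i, y%:Z) | y <- [seq y <- index_iota 0 L | (i, y%:Z) \in finsupp f]]) /=.
  by rewrite big_map.
apply: uniq_perm; first exact/filter_uniq/fset_uniq.
  by rewrite map_inj_uniq ?filter_uniq ?iota_uniq // => a b [].
move=> [a b]; rewrite mem_filter /=; apply/idP/mapP.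
  move=> /andP[/andP[/eqP -> b0] ab]; exists `|b|%N; last by rewrite gez0_abs.
  by rewrite mem_filter mem_index_iota gez0_abs // ab /=; exact: bound ab.
move=> [y]; rewrite mem_filter => /andP[yf _] [-> ->].
by rewrite eqxx yf.
Qed.

(** [evalN] drops negative powers of z, but the skein relation multiplies by z, so the z^-1
    coefficient enters the constant term. *)
Lemma evalN_skein {P} (HP : is_HOMFLY P) N n (w : seq letter) i (x : int) :
  wf_braid (n, w) -> (i.+1 < n)%N ->
  evalN (P (n, w ++ [:: (i, true); (i, true)])) N (x + 1) - evalN (P (n, w)) N (x - 1) =
  P (n, rcons w (i, true)) (x, -1) + N%:Z * evalN (P (n, rcons w (i, true))) N x.
Proof.
move=> wf i_n.
have [L2 E2] := evalN_sum (P (n, w ++ [:: (i, true); (i, true)])) N.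
have [L0 E0] := evalN_sum (P (n, w)) N.
have [L1 E1] := evalN_sum (P (n, rcons w (i, true))) N.
pose L := (L0 + L1 + L2)%N.
rewrite (E2 L.+1) ?(E0 L.+1) ?(E1 L); [|lia..].
rewrite -sumrB; under eq_bigr => y _.
  rewrite -mulrBl; case: HP => _ _ -> //; over.
rewrite big_ord_recl expr0 mulr1 sub0r; congr (_ + _).
rewrite mulr_sumr; apply: eq_bigr => y _.
have -> : (lift ord0 y)%:Z - 1 = y%:Z by rewrite /= /bump /=; lia.
by rewrite mulrCA exprS.
Qed.

(** * Full twists modulo p *)

(* One full twist [sigma_i^2] acts on the pair (coefficient of [a^x] in
   [P_w(a, N)], coefficient of [a^(x+1)] in [(z P_(w sigma_i))(a, N)]) by this
   map, once the degree shift by [a^2] is taken out. *)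
Definition twist_step (R : pzRingType) (c : R) (v : R * R) : R * R :=
  (v.1 + v.2, v.2 + c * (v.1 + v.2)).

Lemma twist_step_inj (R : pzRingType) (c : R) : injective (twist_step R c).
Proof.
move=> [a b] [a' b'] [E]; rewrite /= E => /addIr Eb.
by move: E; rewrite Eb => /addIr ->.
Qed.

Lemma finite_injective_period (T : finType) (f : T -> T) :
  injective f -> exists2 m, (0 < m)%N & forall x, iter m f x = x.
Proof.
move=> fI; exists #[perm fI]%g => [|x]; first exact: order_gt0.
have := permX (perm fI) x #[perm fI]%g; rewrite expg_order perm1 => {2}->.
by apply: eq_iter => y; rewrite permE.
Qed.

(** The z^-1 coefficient is added separately: after multiplication by z it survives even at z =
    0. *)
Definition twist_pair (P : braid -> laurent2) (N n : nat) (i : nat)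
    (w : seq letter) (x : int) : int * int :=
  (evalN (P (n, w)) N x,
   P (n, rcons w (i, true)) (x + 1, -1)
   + N%:Z * evalN (P (n, rcons w (i, true))) N (x + 1)).

(** Apply the skein relation at [w] and at w sigma_i. Since [w2] closes to a knot, its z^-1 and z^-2
    coefficients vanish and no further unknown enters. *)
Lemma twist_pair_step {P} (HP : is_HOMFLY P) N n i (w : seq letter) x :
  is_knot (n, w) -> (i.+1 < n)%N ->
  twist_pair P N n i (w ++ [:: (i, true); (i, true)]) (x + 2) =
  twist_step int (N%:Z ^+ 2) (twist_pair P N n i w x).
Proof.
move=> kn i_n; have [wf _] := kn.
set w2 := w ++ _; have kn2 : is_knot (n, w2) by apply: is_knot_double.
have wf1 : wf_braid (n, rcons w (i, true)).
  move: wf; rewrite !wf_braidE -cats1 letters_below_cat => /andP[-> ->] /=.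
  by rewrite i_n.
have Ew2 : rcons (rcons w (i, true)) (i, true) = w2 by rewrite /w2 -!cats1 -catA.
have Ew3 : rcons w (i, true) ++ [:: (i, true); (i, true)] = rcons w2 (i, true).
  by rewrite /w2 -!cats1 -!catA.
have e3 : x + 2 + 1 = x + 3 by lia.
have e1 : x + 2 - 1 = x + 1 by lia.
have e2 : x + 1 + 1 = x + 2 by lia.
have E1 := evalN_skein HP N n w i (x + 1) wf i_n.
rewrite e2 addrK -/w2 in E1.
have E2 := evalN_skein HP N n (rcons w (i, true)) i (x + 2) wf1 i_n.
rewrite Ew2 Ew3 e3 e1 (homfly_knot_vanishing HP _ _ _ _ kn2) // in E2.
have E3 : P (n, rcons w2 (i, true)) (x + 3, -1) = P (n, rcons w (i, true)) (x + 1, -1).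
  have [_ _ sk] := HP; have := sk n (rcons w (i, true)) i wf1 i_n (x + 2) (-1).
  rewrite Ew2 Ew3 e3 e1 (homfly_knot_vanishing HP _ _ _ _ kn2) //.
  by move/eqP; rewrite subr_eq0 => /eqP.
have {}E1 := canRL (subrK _) E1; have {}E2 := canRL (subrK _) E2.
rewrite /twist_pair e3 E3 E2 E1 add0r /twist_step [_.1]/= [_.2]/=.
by congr (_, _); ring.
Qed.

Lemma twist_pair_iter {P} (HP : is_HOMFLY P) N n i (w : seq letter) (x : int) k :
  is_knot (n, w) -> (i.+1 < n)%N ->
  twist_pair P N n i (w ++ nseq k.*2 (i, true)) (x + k.*2%:Z) =
  iter k (twist_step int (N%:Z ^+ 2)) (twist_pair P N n i w x).
Proof.
move=> kn i_n; elim: k => [|k IH]; first by rewrite cats0 addr0.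
rewrite iterS -IH -twist_pair_step //; last exact: is_knot_nseq.
rewrite -catA -(nseqD _ 2) addn2 doubleS; congr twist_pair; lia.
Qed.

(** [d] is the period of [twist_step] on pairs over F_p, hence is chosen before [P], the strand
    count and the word. *)
Lemma evalN_twist_period N p : prime p -> exists2 d, (0 < d)%N &
  forall P, is_HOMFLY P -> forall n i (w : seq letter) (x : int) k,
  is_knot (n, w) -> (i.+1 < n)%N ->
  (evalN (P (n, w ++ nseq (k * d).*2 (i, true))) N (x + (k * d).*2%:Z))%:~R =
  (evalN (P (n, w)) N x)%:~R :> 'F_p.
Proof.
move=> pp.
have [d d0 per] := finite_injective_period ('F_p * 'F_p)%type _
  (twist_step_inj 'F_p (N%:R ^+ 2)).
exists d => // P HP n i w x k kn i_n.
have := congr1 fst (twist_pair_iter HP N n i w x (k * d) kn i_n).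
rewrite [LHS]/= => ->.
set v := twist_pair _ _ _ _ _ _.
have red m (u : int * int) :
    let r (t : int * int) : 'F_p * 'F_p := (t.1%:~R, t.2%:~R) in
    r (iter m (twist_step int (N%:Z ^+ 2)) u) =
    iter m (twist_step 'F_p (N%:R ^+ 2)) (r u).
  elim: m => // m IH r; rewrite !iterS -IH /r /twist_step /=.
  by rewrite !rmorphD rmorphM rmorphXn /= !rmorphD.
have := congr1 fst (red (k * d)%N v) => /= ->.
suff -> : forall u, iter (k * d) (twist_step 'F_p (N%:R ^+ 2)) u = u by [].
move=> u; elim: k => // k IH.
by rewrite mulSn iterD IH per.
Qed.

Lemma homfly_cancel_nseq {P} (HP : is_HOMFLY P) n (w : seq letter) i k :
  wf_braid (n, w) -> (i.+1 < n)%N ->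
  P (n, (w ++ nseq k (i, false)) ++ nseq k (i, true)) = P (n, w).
Proof.
move=> wf i_n; have := wf; rewrite wf_braidE => /andP[n0 Hw].
have Hs s m : letters_below n (nseq m (i, s)).
  by rewrite /letters_below all_nseq /= i_n orbT.
elim: k => [|k <-]; first by rewrite !cats0.
rewrite -{1}(addn1 k) nseqD /= -!catA /= !(catA w).
apply: (homfly_step HP); last exact: (ms_cancel _ _ _ _ false).
  by rewrite wf_braidE n0 !letters_below_cat Hw !Hs /= i_n Hs.
by rewrite wf_braidE n0 !letters_below_cat Hw !Hs.
Qed.

(** Each full twist shifts degrees by two, so the shift unit is twice the period. *)
Lemma knot_shift N p : prime p -> exists2 d, (0 < d)%N &
  forall P, is_HOMFLY P -> forall n (w : seq letter) (q : int), (1 < n)%N ->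
  is_knot (n, w) -> exists2 w', is_knot (n, w') &
  forall x, (evalN (P (n, w')) N (x + q * d%:Z))%:~R = (evalN (P (n, w)) N x)%:~R :> 'F_p.
Proof.
move=> pp; have [d d0 per] := evalN_twist_period N p pp.
exists d.*2; first by rewrite double_gt0.
move=> P HP n w q n1 kn; have [wf _] := kn.
case: q => k.
  exists (w ++ nseq (k * d).*2 (0%N, true)) => [|x]; first exact: is_knot_nseq.
  rewrite -(per P HP n 0%N w x k kn n1); congr (evalN _ _ _)%:~R; lia.
(* For a negative shift, insert negative twists; positive twists lead back to [w], so the period is
   applied to [w']. *)
set w' := w ++ nseq (k.+1 * d).*2 (0%N, false).
have kn' : is_knot (n, w') by apply: is_knot_nseq.
exists w' => // x.
rewrite -(per P HP n 0%N w' _ k.+1 kn' n1) homfly_cancel_nseq //.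
congr (evalN _ _ _)%:~R; lia.
Qed.

(** * Finitely many profiles *)

(** Excluded middle selects a witness for each index that has one, and [T] is their maximum. *)
Lemma finite_witness_bound (I : finType) (R : I -> nat -> Prop) :
  exists T, forall i, (exists n, R i n) -> exists2 n, (n <= T)%N & R i n.
Proof.
suff [T HT] : exists T, forall i, i \in enum I ->
    (exists n, R i n) -> exists2 n, (n <= T)%N & R i n.
  by exists T => i; apply: HT; rewrite mem_enum.
elim: (enum I) => [|j s [T HT]]; first by exists 0%N.
have [[n Rn]|no] := classic (exists n, R j n).
  exists (maxn n T) => i; rewrite inE => /predU1P[-> _|/HT/[apply] -[m mT Rm]].
    by exists n => //; rewrite leq_maxl.
  by exists m => //; rewrite leq_max mT orbT.
by exists T => i; rewrite inE => /predU1P[-> /no|/HT].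
Qed.

Lemma braid_index_exists (b : braid) :
  exists m, is_braid_index b m /\ (m <= b.1)%N.
Proof.
have: exists b', markov_eq b b' /\ b'.1 = b.1 by exists b; split=> //; apply: rst_refl.
elim/ltn_ind: b.1 => n IH Hn.
have [[m [mn Hm]]|no] := classic (exists m, (m < n)%N /\
    exists b', markov_eq b b' /\ b'.1 = m).
  have [k [Hk km]] := IH m mn Hm; exists k; split=> //.
  exact: leq_trans km (ltnW mn).
exists n; split=> //; split=> // b' Hb'; rewrite leqNgt; apply/negP => lt.
by apply: no; exists b'.1; split=> //; exists b'.
Qed.

(** Twisting needs a generator, so the one-strand unknot is stabilised once. *)
Lemma knot_two_strands {P} (HP : is_HOMFLY P) (K : braid) : is_knot K ->
  exists n (w : seq letter), [/\ (1 < n)%N, is_knot (n, w) & P (n, w) = P K].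
Proof.
case: K => n w kn; have [wf _] := kn.
have [n1|] := ltnP 1 n; first by exists n, w.
case: n w kn wf => [|[|//]] [|[i s] w] // kn wf _.
exists 2%N, [:: (0%N, true)]; split=> //.
  by split=> // -[_|[_|//]]; [exists 0%N|exists 1%N].
by apply/esym/(homfly_step HP) => //; apply: (ms_stab _ [::]).
Qed.

Theorem theorem2 (P : braid -> laurent2) (HP : is_HOMFLY P) :
  forall (N S p : nat), prime p ->
  exists T : nat,
    forall K : braid, is_knot K ->
      (exists i : int, ~~ (p%:Z %| evalN (P K) N i)%Z) ->
      (forall i j : int, ~~ (p%:Z %| evalN (P K) N i)%Z ->
          ~~ (p%:Z %| evalN (P K) N j)%Z -> i - j <= S%:Z) ->
      exists K' : braid,
        [/\ is_knot K',
            (exists bK', is_braid_index K' bK' /\ (bK' <= T)%N) &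
            forall i : int, (evalN (P K') N i == evalN (P K) N i %[mod p%:Z])%Z].
Proof.
move=> N S p pp; have dvd := dvdz_pcharf (pchar_Fp pp).
have [d d0 shift] := knot_shift N p pp.
(* The support lies within [S] of an exponent [i0] that need not be extremal, hence [S.*2]; [d]
   absorbs the rounding of the window's start to a multiple of [d]. *)
pose W := (d + S.*2)%N.
pose window (f : int -> 'F_p) (q : int) (g : {ffun 'I_W.+1 -> 'F_p}) :=
  forall x, f x =
    if 0 <= x - q * d%:Z <= W%:Z then g (inord (absz (x - q * d%:Z)%R)) else 0.
pose ev (b : braid) (x : int) : 'F_p := (evalN (P b) N x)%:~R.
(* The start [q] is existential, so [g] stands for a polynomial up to shifts by multiples of [d]. *)
have [T HT] := finite_witness_bound _ (fun g n => exists w q,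
  [/\ (1 < n)%N, is_knot (n, w) & window (ev (n, w)) q g]).
exists T => K knK [i0 Hi0] span.
pose q := ((i0 - S%:Z) %/ d%:Z)%Z.
pose g := [ffun t : 'I_W.+1 => ev K (q * d%:Z + t%:Z)].
have winK : window (ev K) q g.
  move=> x; case: ifPn => Hx.
    rewrite ffunE; congr (ev _ _); rewrite inordK; lia.
  (* A nonzero coefficient outside the window would be more than [S] away from [i0]. *)
  apply/eqP; rewrite /ev -dvd; apply/negPn/negP => Hx0.
  have := span _ _ Hx0 Hi0; have := span _ _ Hi0 Hx0.
  have := divz_eq (i0 - S%:Z) d%:Z; rewrite -/q.
  have := modz_ge0 (i0 - S%:Z) (d := d%:Z); have := ltz_pmod (i0 - S%:Z) (d := d%:Z).
  move: (_ %% _)%Z => r; move: Hx; rewrite /W; lia.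
have [n nT [w0 [q0 [n1 kn0 win0]]]] : exists2 n, (n <= T)%N & exists w q,
    [/\ (1 < n)%N, is_knot (n, w) & window (ev (n, w)) q g].
  apply: HT; have [n [w [n1 kn E]]] := knot_two_strands HP K knK.
  by exists n, w, q; split=> // x; rewrite /ev E; apply: winK.
(* The selected knot has profile [g] starting at [q0 * d]; twisting moves it to [q * d] on the same
   [n] strands. *)
have [w kn Ew] := shift P HP n w0 (q - q0) n1 kn0.
exists (n, w); split=> //.
  have [m [Hm mn]] := braid_index_exists (n, w).
  by exists m; split=> //; apply: leq_trans mn nT.
move=> x; rewrite eqz_mod_dvd dvd rmorphB subr_eq0 /=; apply/eqP.
rewrite -[X in evalN _ _ X](subrK ((q - q0) * d%:Z)) Ew.
have := win0 (x - (q - q0) * d%:Z); rewrite /ev => ->.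
have := winK x; rewrite /ev => ->.
by have -> : x - (q - q0) * d%:Z - q0 * d%:Z = x - q * d%:Z by ring.
Qed.
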